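(* Let $(g,h) \in \mathbb{F}_2[x] \times \mathbb{F}_2[x]$. Then $(g,h)$ is a minimal representative if and only if one of the following conditions holds: (1) $2\deg g < \deg h$ and $\deg h$ is odd; (2) $2 \deg g = \deg h$; (3) $\deg g > \deg h$.
   Context: The convention $\deg(0) := -\infty$ is used. The additive group $(\mathbb{F}_2[x],+)$ acts on $\mathbb{F}_2[x]\times\mathbb{F}_2[x]$ by $f \cdot (g,h) = (g,\, h + gf + f^2)$ (this is the effect on the polynomial $y^2+gy+h$ of the substitution $y \mapsto y+f$). A pair $(g,h)$ is called a minimal representative if $\deg h$ is minimal in its orbit, i.e. $\deg h \le \deg(h + gf + f^2)$ for every $f \in \mathbb{F}_2[x]$. *)

(* Defs.v *)
From mathcomp Require Import all_boot all_order all_algebra.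
From mathcomp Require Import constructive_ereal.

Set Implicit Arguments.
Unset Strict Implicit.
Unset Printing Implicit Defensive.

Import Order.TTheory GRing.Theory Num.Theory.

Local Open Scope ring_scope.

(* The degree takes values in the extended integers, so that deg 0 = -oo and
   2 * deg 0 = -oo; MathComp's [size p] is 1 + deg p for p != 0. *)
Definition deg (R : nzSemiRingType) (p : {poly R}) : \bar int :=
  if p == 0 then -oo%E else (((size p).-1)%:Z)%:E.

(* An infinite value is not odd; in particular deg 0 is not. *)
Definition odd_ext (d : \bar int) : Prop := exists k : int, d = (2 * k + 1)%:E.

Definition subst_act (f : {poly 'F_2}) (gh : {poly 'F_2} * {poly 'F_2}) :
    {poly 'F_2} * {poly 'F_2} :=
  (gh.1, gh.2 + gh.1 * f + f ^+ 2).

Lemma subst_act0 gh : subst_act 0 gh = gh.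
Proof. by case: gh => g h; rewrite /subst_act /= mulr0 expr0n !addr0. Qed.

Lemma subst_actD f1 f2 gh :
  subst_act (f1 + f2) gh = subst_act f1 (subst_act f2 gh).
Proof.
case: gh => g h; rewrite /subst_act /=; congr (_, _).
have ch2 : 2%N \in [pchar {poly 'F_2}] by rewrite pchar_poly pchar_Fp.
have f0 : (f1 * f2) *+ 2 = 0 by rewrite -mulr_natr (pcharf0 ch2) mulr0.
by rewrite sqrrD f0 addr0 mulrDr -addrA addrACA [_ + _ + (_ + _)]addrC !addrA.
Qed.

Definition minimal_representative (gh : {poly 'F_2} * {poly 'F_2}) : Prop :=
  forall f : {poly 'F_2}, (deg gh.2 <= deg (subst_act f gh).2)%E.

(* Main.v *)
Require Import Defs.
From mathcomp Require Import all_boot all_order all_algebra.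
From mathcomp Require Import constructive_ereal.
From mathcomp Require Import zify.

Import Order.TTheory GRing.Theory Num.Theory.

Local Open Scope ring_scope.

(** The action adds [f * (g + f)] to [h], a polynomial of degree
    [deg f + deg (g + f)], so the leading term of [h] can be cancelled in only
    two ways, up to exchanging [f] and [g + f]: with [f] of degree [deg h / 2]
    when [2 deg g < deg h], and with [f] of degree [deg h - deg g] when
    [deg g <= deg h < 2 deg g]. Over F_2 all leading coefficients are 1, so a
    monomial [f] of that degree does cancel it. When [2 deg g = deg h] no [f]
    does, because [g] and [f] of the same degree cancel in [g + f]. *)

Lemma deg_le (R : nzSemiRingType) (p q : {poly R}) :
  (deg p <= deg q)%E = (size p <= size q)%N.
Proof.
rewrite /deg; have [->|p0] := eqVneq p 0; first by rewrite size_poly0 leNye.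
have [->|q0] := eqVneq q 0.
  by rewrite leeNy_eq size_poly0 leqn0 size_poly_eq0 (negPf p0).
by rewrite lee_fin lez_nat; move: p0 q0; rewrite -!size_poly_gt0; lia.
Qed.

Lemma deg_lt (R : nzSemiRingType) (p q : {poly R}) :
  (deg p < deg q)%E = (size p < size q)%N.
Proof. by rewrite ltNge deg_le -ltnNge. Qed.

Lemma double_degN0 (R : nzSemiRingType) (p : {poly R}) :
  p != 0 -> (2%:E * deg p)%E = (((size p).-1.*2)%:Z)%:E.
Proof. by move=> /negPf p0; rewrite /deg p0 -EFinM; congr (_%:E); lia. Qed.

Lemma double_deg0 (R : nzSemiRingType) : (2%:E * deg (0 : {poly R}))%E = -oo%E.
Proof. by rewrite /deg eqxx gt0_muleNy // lte_fin. Qed.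

(** For nonzero [p] and [q], [2 (size p - 1) < size q - 1] amounts to [2 size p <= size q]; for
    [p = 0] the left side is -oo, so only [q != 0] remains. *)
Lemma double_deg_lt (R : nzSemiRingType) (p q : {poly R}) :
  (2%:E * deg p < deg q)%E = (q != 0) && ((size p).*2 <= size q)%N.
Proof.
have [->|p0] := eqVneq p 0.
  rewrite double_deg0 size_poly0 andbT /deg.
  by case: eqVneq => _; rewrite ?ltxx ?ltNyr.
rewrite double_degN0 // /deg; have [//|q0] := eqVneq q 0.
rewrite lte_fin ltz_nat /=.
by move: p0 q0; rewrite -!size_poly_gt0; lia.
Qed.

(** The truncated predecessor covers zero: [size p = 0] yields 0, in accordance with [deg 0] being
    -oo. *)
Lemma double_deg_eq (R : nzSemiRingType) (p q : {poly R}) :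
  (2%:E * deg p)%E = deg q <-> (size p).*2.-1 = size q.
Proof.
have [->|p0] := eqVneq p 0.
  rewrite double_deg0 size_poly0 /deg; have [->|q0] := eqVneq q 0.
    by rewrite size_poly0.
  by split=> // /esym/eqP; rewrite size_poly_eq0 (negPf q0).
rewrite double_degN0 // /deg; have [->|q0] := eqVneq q 0.
  by move: p0; rewrite -size_poly_gt0 size_poly0; split=> //; lia.
move: p0 q0; rewrite -!size_poly_gt0 => p0 q0; split=> [[]|e]; first lia.
by congr (_%:Z%:E); lia.
Qed.

Lemma odd_ext_deg (R : nzSemiRingType) (p : {poly R}) :
  p != 0 -> odd_ext (deg p) <-> ~~ odd (size p).
Proof.
move=> p0; rewrite /deg (negPf p0); move: p0; rewrite -size_poly_gt0 => p0.
split=> [[k []]|e]; first lia.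
by exists ((size p).-1./2)%:Z; congr (_%:E); lia.
Qed.

Lemma lead_coef_F2 (p : {poly 'F_2}) : p != 0 -> lead_coef p = 1.
Proof.
rewrite -lead_coef_eq0; case: (lead_coef p) => [[|[|//]] i] // _.
exact: val_inj.
Qed.

(** Both leading coefficients are 1, and [1 + 1 = 0]. *)
Lemma size_polyD_lt_F2 (p q : {poly 'F_2}) :
  p != 0 -> size p = size q -> (size (p + q)%R < size p)%N.
Proof.
move=> p0 epq; have p_gt0 : (0 < size p)%N by rewrite size_poly_gt0.
have q0 : q != 0 by rewrite -size_poly_gt0 -epq.
rewrite -[X in (_ < X)%N](prednK p_gt0) ltnS.
apply/leq_sizeP => j; rewrite leq_eqVlt => /predU1P[<-|ltj].
  rewrite coefD {2}epq -!lead_coefE !lead_coef_F2 //; exact: val_inj.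
by rewrite prednK // in ltj; rewrite coefD !nth_default ?addr0 -?epq.
Qed.

(** Leading terms of different degrees cannot cancel. For minimality it thus suffices that
    [f * (g + f)] never has the size of [h]. *)
Lemma leq_size_polyD (R : nzRingType) (p q : {poly R}) :
  size p != size q -> (size p <= size (p + q)%R)%N.
Proof.
case: (ltngtP (size p) (size q)) => // lt_pq _.
  by rewrite addrC size_polyDl // ltnW.
by rewrite size_polyDl.
Qed.

Definition size_minimal (g h : {poly 'F_2}) : Prop :=
  forall f : {poly 'F_2}, (size h <= size (h + f * (g + f))%R)%N.

Lemma minimal_representativeE (g h : {poly 'F_2}) :
  minimal_representative (g, h) <-> size_minimal g h.
Proof.
by split=> min_h f; have := min_h f;
  rewrite deg_le /subst_act /= -addrA mulrDr -expr2 [f * g]mulrC.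
Qed.

(* [lia] identifies sizes only when they are written with the same structure
   instances, so the library facts about sizes are restated over 'F_2. *)
Lemma size_mul_F2 (p q : {poly 'F_2}) :
  p != 0 -> q != 0 -> size (p * q)%R = (size p + size q).-1.
Proof. exact: size_mul. Qed.

Lemma size_polyMleq_F2 (p q : {poly 'F_2}) :
  (size (p * q)%R <= (size p + size q).-1)%N.
Proof. exact: size_polyMleq. Qed.

Lemma size_polyD_F2 (p q : {poly 'F_2}) :
  (size (p + q)%R <= maxn (size p) (size q))%N.
Proof. exact: size_polyD. Qed.

Lemma size_polyDl_F2 (p q : {poly 'F_2}) :
  (size q < size p)%N -> size (p + q)%R = size p.
Proof. exact: size_polyDl. Qed.

Lemma size_polyDr_F2 (p q : {poly 'F_2}) :
  (size p < size q)%N -> size (p + q)%R = size q.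
Proof. by rewrite addrC; exact: size_polyDl. Qed.

(** One of [f] and [g + f] is at least as large as [g], so their product, if nonzero, is larger than
    [h]. *)
Lemma size_minimal_lt (g h : {poly 'F_2}) :
  (size h < size g)%N -> size_minimal g h.
Proof.
move=> lt_hg f; have [->|f0] := eqVneq f 0; first by rewrite mul0r addr0.
have [->|gf0] := eqVneq (g + f) 0; first by rewrite mulr0 addr0.
suff ne : size h != size (f * (g + f))%R by exact: leq_size_polyD.
have s_g : (size g <= maxn (size (g + f)%R) (size f))%N.
  by have := size_polyD_F2 (g + f) (- f); rewrite addrK size_polyN.
by rewrite size_mul_F2 //; move: f0 gf0; rewrite -!size_poly_gt0; lia.
Qed.

(** If [f] is larger than [g], the product has the odd size [2 size f - 1]; otherwise its size stays
    below that of [h]. *)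
Lemma size_minimal_even (g h : {poly 'F_2}) :
  h != 0 -> ((size g).*2 <= size h)%N -> ~~ odd (size h) -> size_minimal g h.
Proof.
move=> h0 le_gh even_h f.
suff ne : size h != size (f * (g + f))%R by exact: leq_size_polyD.
move: h0; rewrite -size_poly_gt0 => h0.
have [lt_gf|le_fg] := ltnP (size g) (size f).
  have s_gf := size_polyDr_F2 g f lt_gf.
  have f0 : f != 0 by rewrite -size_poly_gt0; lia.
  have gf0 : g + f != 0 by rewrite -size_poly_gt0 s_gf; lia.
  by rewrite size_mul_F2 // s_gf; lia.
by have := size_polyMleq_F2 f (g + f); have := size_polyD_F2 g f; lia.
Qed.

Lemma size_minimal_eq (g h : {poly 'F_2}) :
  (size g).*2.-1 = size h -> size_minimal g h.
Proof.
move=> e_gh f; have [->|f0] := eqVneq f 0; first by rewrite mul0r addr0.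
have f_gt0 : (0 < size f)%N by rewrite size_poly_gt0.
have [g0|g_gt0] := posnP (size g); first by move: e_gh; rewrite g0 => <-.
have g0 : g != 0 by rewrite -size_poly_gt0.
suff ne : size h != size (f * (g + f))%R by exact: leq_size_polyD.
have le_m := size_polyMleq_F2 f (g + f).
case: (ltngtP (size f) (size g)) => [lt_fg|lt_gf|e_fg].
- by have := size_polyDl_F2 g f lt_fg; lia.
- have s_gf := size_polyDr_F2 g f lt_gf.
  have gf0 : g + f != 0 by rewrite -size_poly_gt0 s_gf.
  by rewrite size_mul_F2 // s_gf; lia.
(* The leading terms of [g] and [f] cancel in [g + f]. *)
by have := size_polyD_lt_F2 g f g0 (esym e_fg); lia.
Qed.

Lemma size_minimal_odd_F (g h : {poly 'F_2}) :
  odd (size h) -> ((size g).*2 <= size h)%N -> ~ size_minimal g h.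
Proof.
(* As [size h] is odd, the exponent is exactly half the degree of [h]; it exceeds the degree of [g],
   so [f] and [g + f] share it. *)
move=> odd_h le_gh /(_ 'X^((size h)./2)).
have h0 : h != 0 by rewrite -size_poly_gt0; lia.
set f : {poly 'F_2} := 'X^_.
have s_f : size f = (size h)./2.+1 by exact: size_polyXn.
have s_gf : size (g + f)%R = size f by apply: size_polyDr_F2; lia.
have f0 : f != 0 by rewrite -size_poly_gt0 s_f.
have gf0 : g + f != 0 by rewrite -size_poly_gt0 s_gf s_f.
have e : size h = size (f * (g + f))%R by rewrite size_mul_F2 // s_gf; lia.
by have := size_polyD_lt_F2 h _ h0 e; lia.
Qed.

Lemma size_minimal_mid_F (g h : {poly 'F_2}) :
  (size g <= size h)%N -> (size h < (size g).*2.-1)%N -> ~ size_minimal g h.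
Proof.
(* The exponent is [deg h - deg g]. The upper bound on [size h] puts it below [deg g], so [g + f]
   keeps the degree of [g]. *)
move=> le_gh lt_hg /(_ 'X^(size h - size g)).
have h0 : h != 0 by rewrite -size_poly_gt0; lia.
set f : {poly 'F_2} := 'X^_.
have s_f : size f = (size h - size g).+1 by exact: size_polyXn.
have s_gf : size (g + f)%R = size g by apply: size_polyDl_F2; lia.
have f0 : f != 0 by rewrite -size_poly_gt0 s_f.
have gf0 : g + f != 0 by rewrite -size_poly_gt0 s_gf; lia.
have e : size h = size (f * (g + f))%R by rewrite size_mul_F2 // s_gf; lia.
by have := size_polyD_lt_F2 h _ h0 e; lia.
Qed.

Theorem theorem3p2 (g h : {poly 'F_2}) :
  minimal_representative (g, h) <->
  [\/ (2%:E * deg g < deg h)%E /\ odd_ext (deg h),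
      (2%:E * deg g)%E = deg h
    | (deg h < deg g)%E].
Proof.
rewrite minimal_representativeE double_deg_lt deg_lt.
split=> [min_h|[[/andP[h0 le_gh] /(odd_ext_deg _ _ h0)]|/double_deg_eq|]];
  first last.
- exact: size_minimal_lt.
- exact: size_minimal_eq.
- exact: size_minimal_even.
have [lt_hg|le_gh] := ltnP (size h) (size g); first by constructor 3.
have [h0|h0] := eqVneq h 0.
  (* Here [g] vanishes too, and both sides of the equality are -oo. *)
  by constructor 2; apply/double_deg_eq; move: le_gh; rewrite h0 size_poly0; lia.
have [le_2gh|lt_h2g] := leqP (size g).*2 (size h).
  constructor 1; split=> //; apply/(odd_ext_deg _ _ h0)/negP => odd_h.
  exact: (size_minimal_odd_F g h).
have [lt_hg|le_hg] := ltnP (size h) (size g).*2.-1.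
  by case: (size_minimal_mid_F g h).
by constructor 2; apply/double_deg_eq; lia.
Qed.
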